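(* Let $d,n\ge 1$ be integers and let $Q\in M_d(\mathbb{C})$ be a matrix which has $d$ distinct eigenvalues $\lambda_1,\lambda_2,\dots,\lambda_d$. Let $A_1,\dots,A_n\in C(Q)$, with representation polynomials $f_1(x),f_2(x),\dots,f_n(x)$, respectively. For $i=1,2,\dots,d$ let $n_i$ denote the number of distinct complex roots of the polynomial $$g_i(x)=x^n+f_1(\lambda_i)x^{n-1}+f_2(\lambda_i)x^{n-2}+\dots+f_{n-1}(\lambda_i)x+f_n(\lambda_i).$$ Then the total number of solutions $X\in C(Q)$ of the equation $$X^n+A_1X^{n-1}+A_2X^{n-2}+\dots+A_{n-1}X+A_n=O$$ is $\prod_{i=1}^{d}n_i$.
   Context: For $Q\in M_d(\mathbb{C})$, $C(Q)=\{X\in M_d(\mathbb{C}): QX=XQ\}$. A matrix is non-derogatory if each of its eigenvalues has geometric multiplicity $1$ (in particular, a $d\times d$ matrix with $d$ distinct eigenvalues is non-derogatory). For non-derogatory $Q$, the elements of $C(Q)$ are called $Q$-circulant matrices; it is known that $C(Q)$ is a commutative $\mathbb{C}$-algebra with $\mathbb{C}$-basis $\{I,Q,Q^2,\dots,Q^{d-1}\}$. If $A\in C(Q)$ is written (uniquely) as $A=\sum_{i=0}^{d-1}a_iQ^i$ with $a_i\in\mathbb{C}$, the polynomial $\sum_{i=0}^{d-1}a_ix^i$ is called the representation polynomial of $A$. $O$ denotes the $d\times d$ zero matrix. *)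

(* Defs.v *)
From mathcomp Require Import all_boot all_order all_algebra.
From mathcomp Require Import complex finmap.
From mathcomp Require Import boolp classical_sets cardinality reals.

Set Implicit Arguments.
Unset Strict Implicit.
Unset Printing Implicit Defensive.

Import Order.TTheory GRing.Theory Num.Theory.

Local Open Scope ring_scope.
Local Open Scope classical_set_scope.

Definition commutant (K : fieldType) (d : nat) (Q : 'M[K]_d) : set 'M[K]_d :=
  [set X | comm_mx Q X].

Definition is_representation_poly (K : fieldType) (d : nat)
    (Q A : 'M[K]_d) (f : {poly K}) : Prop :=
  (size f <= d)%N /\ A = \sum_(i < d) f`_i *: Q ^+ i.

(* [fset_set] returns the empty set on infinite sets, so that this is the
   number of distinct roots only for [p != 0]. *)
Definition num_distinct_roots (K : fieldType) (p : {poly K}) : nat :=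
  #|` fset_set [set x : K | root p x] |%fset.

(* [f k] and [A k], for [k : 'I_n], stand for f_(k+1) and A_(k+1), which
   multiply the power of exponent n - (k+1). *)
Definition eigen_poly (K : fieldType) (n : nat) (f : 'I_n -> {poly K}) (a : K) :
    {poly K} :=
  'X^n + \sum_(k < n) (f k).[a] *: 'X^(n - k.+1).

Definition matrix_eqn_lhs (K : fieldType) (d n : nat) (A : 'I_n -> 'M[K]_d)
    (X : 'M[K]_d) : 'M[K]_d :=
  X ^+ n + \sum_(k < n) A k *m X ^+ (n - k.+1).

(* Main.v *)
Require Import Defs.
From mathcomp Require Import all_boot all_order all_algebra.
From mathcomp Require Import complex finmap.
From mathcomp Require Import boolp classical_sets cardinality reals.

Set Implicit Arguments.
Unset Strict Implicit.
Unset Printing Implicit Defensive.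

Import Order.TTheory GRing.Theory Num.Theory.

Local Open Scope ring_scope.
Local Open Scope classical_set_scope.
Local Open Scope card_scope.

(** The statement holds over every field [K], since all the matrices involved
    become diagonal in one common basis. As [Q] has [d] distinct eigenvalues,
    its (row) eigenvectors [v_i] form a basis of the space of row vectors
    ([row_free_eigenvectors]). A matrix [X] commutes with [Q] exactly when each
    [v_i] is also an eigenvector of [X], because [X] preserves the eigenspaces
    of [Q], which are lines ([commutantP]). So [X] is the same thing as the
    family [x_i] of its eigenvalues.

    On [v_i] the coefficient [A_k] acts as the scalar [f_k(lambda_i)], hence
    the left-hand side of the equation acts as [g_i(x_i)]
    ([matrix_eqn_lhs_eigenvector]), and it vanishes if and only if [x_i] is a
    root of [g_i] for each [i]. The solutions therefore correspond to the
    independent choices of one root of each [g_i]; these are counted by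
    [card_eq_fset_family], the polynomials [g_i] being nonzero. *)

(** * Counting families of choices *)

Lemma card_eq_fset_family (I : finType) (K : choiceType) (F : I -> {fset K}) :
  [set y : {ffun I -> K} | forall i, y i \in F i] #= `I_(\prod_i #|` F i|)%N.
Proof.
(* Such a family is a dependent function with values in the finite types [F i]. *)
pose T := {dffun forall i, F i}.
have cardT : #|T| = (\prod_i #|` F i|)%N.
  rewrite card_dep_ffun foldrE big_map big_enum.
  by apply: eq_bigr => i _; rewrite cardfE.
pose h (t : T) : {ffun I -> K} := [ffun i => val (t i)].
have h_inj : injective h.
  move=> s t /ffunP st; apply/ffunP => i; apply/val_inj.
  by have := st i; rewrite !ffunE.
have -> : [set y : {ffun I -> K} | forall i, y i \in F i] = h @` [set: T].
  apply/seteqP; split=> [y Fy|_ [t _ <-] i]; last by rewrite ffunE; apply: valP.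
  exists (finfun (fun i => FSetSub (Fy i))) => //.
  by apply/ffunP => i; rewrite !ffunE.
rewrite -cardT (card_eql (inj_card_eq (in2W h_inj))).
rewrite -(card_eql (inj_card_eq (in2W (@enum_rank_inj T)))).
rewrite (card_eqr card_II).
suff -> : enum_rank @` [set: T] = [set: 'I_#|T|] by apply: card_eqxx.
by apply/seteqP; split=> // k _; exists (enum_val k) => //; rewrite enum_valK.
Qed.

(** * Matrices acting on a common eigenvector *)

Section CommonEigenvector.

Variables (K : fieldType) (d : nat) (v : 'rV[K]_d).

Lemma mulmx_exp_eigenvector (X : 'M[K]_d) (x : K) (m : nat) :
  v *m X = x *: v -> v *m X ^+ m = x ^+ m *: v.
Proof.
move=> vX; elim: m => [|m IHm]; first by rewrite !expr0 mulmx1 scale1r.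
by rewrite exprSr mulmxA IHm -scalemxAl vX scalerA exprSr.
Qed.

Lemma representation_poly_eigenvector (Q A : 'M[K]_d) (f : {poly K}) (a : K) :
  is_representation_poly Q A f -> v *m Q = a *: v -> v *m A = f.[a] *: v.
Proof.
move=> [szf ->] vQ; rewrite mulmx_sumr (horner_coef_wide _ szf) scaler_suml.
apply: eq_bigr => i _.
by rewrite -scalemxAr (mulmx_exp_eigenvector i vQ) scalerA.
Qed.

(** The [A_k] stand to the left of the powers of [X], but on a common
    eigenvector every factor acts as a scalar, so the matrix equation becomes
    the scalar equation in the eigenvalue [x] of [X]. *)
Lemma matrix_eqn_lhs_eigenvector (n : nat) (Q X : 'M[K]_d)
    (A : 'I_n -> 'M[K]_d) (f : 'I_n -> {poly K}) (a x : K) :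
  (forall k, is_representation_poly Q (A k) (f k)) ->
  v *m Q = a *: v -> v *m X = x *: v ->
  v *m matrix_eqn_lhs A X = (eigen_poly f a).[x] *: v.
Proof.
move=> hf vQ vX; rewrite mulmxDr (mulmx_exp_eigenvector n vX) mulmx_sumr.
rewrite hornerD hornerXn horner_sum scalerDl scaler_suml; congr (_ + _).
apply: eq_bigr => k _; rewrite hornerZ hornerXn mulmxA.
rewrite (representation_poly_eigenvector (hf k) vQ) -scalemxAl.
by rewrite (mulmx_exp_eigenvector _ vX) scalerA.
Qed.

End CommonEigenvector.

(** Its leading term is [X^n]. This makes the root set finite, so that
    [fset_set] in [num_distinct_roots] does enumerate it. *)
Lemma eigen_poly_neq0 (K : fieldType) (n : nat) (f : 'I_n -> {poly K}) (a : K) :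
  eigen_poly f a != 0.
Proof.
rewrite -size_poly_gt0 /eigen_poly size_polyDl ?size_polyXn // ltnS.
apply: (leq_trans (size_sum _ _ _)); apply/bigmax_leqP => k _.
by apply: (leq_trans (size_scale_leq _ _)); rewrite size_polyXn subnSK ?leq_subr.
Qed.

Lemma finite_set_root (K : fieldType) (p : {poly K}) :
  p != 0 -> finite_set [set x | root p x].
Proof.
move=> p0; apply: contrapT => /(infinite_set_fset (size p)) [B Bp szB].
have rB : all (root p) (enum_fset B) by apply/allP => x /Bp.
by have := max_poly_roots p0 rB (fset_uniq B); rewrite ltnNge szB.
Qed.

(** * The commutant of a matrix with distinct eigenvalues *)

(** In a vanishing combination [u] of the eigenvectors, each term [u_i v_i] lies
    in its own eigenspace and, being minus the sum of the others, also in the sum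
    of the other eigenspaces; eigenspaces of distinct eigenvalues are in direct
    sum, so each term is zero. *)
Lemma row_free_eigenvectors (K : fieldType) (m d : nat) (Q : 'M[K]_d)
    (lambda : 'I_m -> K) (P : 'M[K]_(m, d)) :
  injective lambda ->
  (forall i, row i P *m Q = lambda i *: row i P) ->
  (forall i, row i P != 0) -> row_free P.
Proof.
move=> lambda_inj PQ P0; rewrite -kermx_eq0; apply/eqP/row_matrixP => j.
rewrite row0; set u := row j _.
have uP : u *m P = 0 by rewrite -row_mul mulmx_ker row0.
have dS : mxdirect (\sum_i eigenspace Q (lambda i)).
  by apply: mxdirect_sum_eigenspace => i k _ _ /lambda_inj.
have uE i : (u 0 i *: row i P <= eigenspace Q (lambda i))%MS.
  by apply: scalemx_sub; apply/eigenspaceP.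
apply/rowP => i; rewrite [RHS]mxE.
suff : u 0 i *: row i P == 0 by rewrite scaler_eq0 (negPf (P0 i)) orbF => /eqP.
rewrite -submx0 -(mxdirect_sumsP dS i isT) sub_capmx uE /=.
have /eqP : u 0 i *: row i P + \sum_(k | k != i) u 0 k *: row k P = 0.
  by rewrite -[RHS]uP mulmx_sum_row [RHS](bigD1 i).
rewrite addr_eq0 => /eqP ->; rewrite eqmx_opp.
by apply: summx_sub_sums => k _; apply: uE.
Qed.

Lemma eigenbasis (K : fieldType) (d : nat) (Q : 'M[K]_d) (lambda : 'I_d -> K) :
  injective lambda -> (forall i, eigenvalue Q (lambda i)) ->
  exists2 P : 'M[K]_d, P \in unitmx &
    forall i, row i P *m Q = lambda i *: row i P.
Proof.
move=> lambda_inj eigQ.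
have /choice[v vP] : forall i, exists v : 'rV_d, v *m Q = lambda i *: v /\ v != 0.
  by move=> i; have /eigenvalueP[v vQ v0] := eigQ i; exists v; split.
have PQ i : row i (\matrix_i v i) *m Q = lambda i *: row i (\matrix_i v i).
  by rewrite rowK; have [] := vP i.
exists (\matrix_i v i) => //; rewrite -row_free_unit.
by apply: (row_free_eigenvectors lambda_inj) => // i; rewrite rowK; have [] := vP i.
Qed.

(** If [X] commutes with [Q], write [v_i X = \sum_j c_j v_j]. Applying [Q] gives
    [\sum_j (lambda_j - lambda_i) c_j v_j = 0], hence [c_j = 0] for [j != i].
    Conversely, two matrices which are both diagonal in the basis [P] commute. *)
Lemma commutantP (K : fieldType) (d : nat) (Q P : 'M[K]_d) (lambda : 'I_d -> K)
    (X : 'M[K]_d) :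
  injective lambda -> P \in unitmx ->
  (forall i, row i P *m Q = lambda i *: row i P) ->
  commutant Q X <-> exists x : {ffun 'I_d -> K}, forall i, row i P *m X = x i *: row i P.
Proof.
move=> lambda_inj uP PQ; split=> [QX|[x PX]].
  have rowX i : exists a, row i P *m X = a *: row i P.
    pose c := row i P *m X *m invmx P.
    have cP : row i P *m X = \sum_j c 0 j *: row j P.
      by rewrite -mulmx_sum_row mulmxKV.
    exists (c 0 i); rewrite cP (bigD1 i) //= big1 ?addr0 // => j ji.
    suff /eqP : (lambda j - lambda i) * c 0 j = 0.
      rewrite mulf_eq0 subr_eq0 (inj_eq lambda_inj) (negPf ji) => /eqP ->.
      by rewrite scale0r.
    have cE : \row_j ((lambda j - lambda i) * c 0 j) *m P = 0.
      rewrite mulmx_sum_row.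
      transitivity (row i P *m X *m Q - lambda i *: (row i P *m X)).
        rewrite cP mulmx_suml scaler_sumr -sumrB; apply: eq_bigr => k _.
        by rewrite mxE -scalemxAl PQ !scalerA -scalerBl mulrBl [lambda k * _]mulrC.
      by rewrite -mulmxA -QX mulmxA PQ -scalemxAl subrr.
    have /rowP/(_ j) : \row_j ((lambda j - lambda i) * c 0 j) = 0.
      by rewrite -[LHS](mulmxK uP) cE mul0mx.
    by rewrite !mxE.
  have [x xP] := choice rowX.
  by exists (finfun x) => i; rewrite ffunE.
apply: (can_inj (mulKmx uP)); apply/row_matrixP => i.
by rewrite !row_mul !mulmxA PQ PX -!scalemxAl PX PQ !scalerA mulrC.
Qed.

(** * The solution set *)

Section Solutions.

Variables (K : fieldType) (d n : nat) (Q P : 'M[K]_d) (lambda : 'I_d -> K).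
Hypotheses (lambda_inj : injective lambda) (uP : P \in unitmx).
Hypothesis PQ : forall i, row i P *m Q = lambda i *: row i P.
Variables (A : 'I_n -> 'M[K]_d) (f : 'I_n -> {poly K}).
Hypothesis hf : forall k, is_representation_poly Q (A k) (f k).

(** The matrix which is diagonal in the basis [P], with eigenvalues [x]; this
    inverts the map of [commutantP] from [X] to its family of eigenvalues. *)
Definition with_eigenvalues (x : {ffun 'I_d -> K}) : 'M[K]_d :=
  invmx P *m (\matrix_i (x i *: row i P)).

Lemma row_with_eigenvalues (x : {ffun 'I_d -> K}) (i : 'I_d) :
  row i P *m with_eigenvalues x = x i *: row i P.
Proof. by rewrite -row_mul mulKVmx // rowK. Qed.

Lemma row_basis_neq0 (i : 'I_d) : row i P != 0.
Proof.
apply/eqP; rewrite rowE => /(canRL (mulmxK uP)); rewrite mul0mx.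
by move=> /matrixP/(_ 0 i)/eqP; rewrite !mxE !eqxx oner_eq0.
Qed.

Lemma with_eigenvalues_inj : injective with_eigenvalues.
Proof.
move=> x y xy; apply/ffunP => i; apply/eqP; rewrite -subr_eq0.
have /eqP : (x i - y i) *: row i P = 0.
  by rewrite scalerBl -!row_with_eigenvalues xy subrr.
by rewrite scaler_eq0 (negPf (row_basis_neq0 i)) orbF.
Qed.

Lemma solutionsE :
  [set X : 'M[K]_d | commutant Q X /\ matrix_eqn_lhs A X = 0] =
  with_eigenvalues @`
    [set x : {ffun 'I_d -> K} | forall i, root (eigen_poly f (lambda i)) (x i)].
Proof.
apply/seteqP; split=> [X [/(commutantP _ lambda_inj uP PQ)[x PX] X0]|].
  exists x => [i|].
    have := matrix_eqn_lhs_eigenvector hf (PQ i) (PX i).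
    rewrite X0 mulmx0 => /esym/eqP.
    by rewrite scaler_eq0 (negPf (row_basis_neq0 i)) orbF.
  apply: (can_inj (mulKmx uP)); apply/row_matrixP => i.
  by rewrite !row_mul row_with_eigenvalues PX.
move=> _ [x rx <-]; have PX := row_with_eigenvalues x; split.
  by apply/(commutantP _ lambda_inj uP PQ); exists x.
apply: (can_inj (mulKmx uP)); apply/row_matrixP => i.
rewrite !row_mul (matrix_eqn_lhs_eigenvector hf (PQ i) (PX i)).
by rewrite (rootP (rx i)) scale0r mulmx0.
Qed.

End Solutions.

Theorem corollary1p1 (R : realType) (d n : nat) (hd : (1 <= d)%N)
    (hn : (1 <= n)%N) (Q : 'M[R[i]]_d) (lambda : 'I_d -> R[i])
    (lambda_inj : injective lambda)
    (lambda_eig : forall i : 'I_d, eigenvalue Q (lambda i))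
    (A : 'I_n -> 'M[R[i]]_d) (hA : forall k : 'I_n, commutant Q (A k))
    (f : 'I_n -> {poly R[i]})
    (hf : forall k : 'I_n, is_representation_poly Q (A k) (f k)) :
  [set X : 'M[R[i]]_d | commutant Q X /\ matrix_eqn_lhs A X = 0] #=
    `I_(\prod_(i < d) num_distinct_roots (eigen_poly f (lambda i)))%N.
Proof.
have [P uP PQ] := eigenbasis lambda_inj lambda_eig.
rewrite (solutionsE lambda_inj uP PQ hf).
rewrite (card_eql (inj_card_eq (in2W (with_eigenvalues_inj uP)))).
have -> : [set x : {ffun 'I_d -> R[i]} |
            forall i, root (eigen_poly f (lambda i)) (x i)] =
    [set x | forall i, x i \in
       fset_set [set z | root (eigen_poly f (lambda i)) z]].
  by apply: eq_set => x; apply: eq_forall => i;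
    rewrite in_fset_set ?inE //; apply/finite_set_root/eigen_poly_neq0.
exact: card_eq_fset_family.
Qed.
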